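(* Let $m\ge n\ge 1$, $k=\lceil\log_2 m\rceil$, and let $V,W,d$, feasible coefficient vectors, the distance phases $\Phi_c$, and the token circuit be as defined in the context. Let $c,c'\in\mathbb{R}^{2^{2k}}$ be two feasible coefficient vectors, i.e. $\sum_j W_{zj}c_j=\sum_j W_{zj}c'_j=d(a,b)$ for every $z=a+2^kb\in V$. Then: (i) For every real $\gamma$, every real net weight $w$, and all valid site labels $a,b\in\{0,\dots,m-1\}$, the distance phases agree on the basis state $|a\rangle|b\rangle$: $$\Phi_c(\gamma,w)\,|a\rangle|b\rangle=\Phi_{c'}(\gamma,w)\,|a\rangle|b\rangle=e^{-i\gamma w\,d(a,b)}|a\rangle|b\rangle .$$ (ii) Consequently, for every list of parameters $\theta=(\beta_0,\gamma_1,\beta_1,\dots,\gamma_{p-1},\beta_{p-1})$, replacing every cost phase of the token circuit by the one built from $c$ or by the one built from $c'$ preserves the prepared state exactly: if $U_C^{\ast}(\gamma)$ is any diagonal unitary acting on each permutation basis state with real-cell assignment $f$ as multiplication by $e^{-i\gamma C(f)}$, then the state $|\psi(\theta)\rangle$ is the same vector whether the cost phases are $U_C^{\ast}$, $U_C^{c}$ or $U_C^{c'}$. (iii) If $m=2^k$, then the feasibility equalities uniquely determine all coefficients (there is exactly one feasible coefficient vector).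
   Context: Placement problem. There are $n$ cells and $m\ge n$ sites labeled $0,\dots,m-1$; site $s$ has planar coordinates $(x_s,y_s)$ and $d(a,b)=|x_a-x_b|+|y_a-y_b|$ is the Manhattan distance. A finite set $E$ of weighted nets $(u,v,w)$ ($u\ne v$ cells, $w$ a real weight) defines the cost of an injective assignment $f:\{0,\dots,n-1\}\to\{0,\dots,m-1\}$ by $C(f)=\sum_{(u,v,w)\in E}w\,d(f(u),f(v))$. Walsh expansion. For $z,j\in\{0,\dots,2^{2k}-1\}$ let $W_{zj}=(-1)^{\mathrm{popcount}(z\,\&\,j)}$, where $\&$ is bitwise AND and popcount counts set bits. A pair of $k$-bit labels $(a,b)$ is encoded as $z=a+2^kb$. The set of valid encoded pairs is $V=\{a+2^kb:0\le a,b<m\}$ (equal-site pairs $a=b$ included). A coefficient vector $c\in\mathbb{R}^{2^{2k}}$ is feasible if $\sum_jW_{zj}c_j=d(a,b)$ for all $z=a+2^kb\in V$. Distance phase. On two $k$-qubit registers, $Z_j$ denotes the product of Pauli-$Z$ operators on the qubits selected by the bit mask $j$ ($Z_0=I$), so that $Z_j|a\rangle|b\rangle=W_{zj}|a\rangle|b\rangle$ with $z=a+2^kb$. The distance phase is $\Phi_c(\gamma,w)=\exp[-i\gamma w\sum_jc_jZ_j]$ (the constant term $j=0$ is included). Token circuit. There are $m$ registers of $k$ qubits each: registers $0,\dots,n-1$ for the cells and $n,\dots,m-1$ for labeled vacancy tokens. A permutation basis state is a computational basis state $|s_0\rangle\cdots|s_{m-1}\rangle$ where $(s_0,\dots,s_{m-1})$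 is a permutation of $\{0,\dots,m-1\}$; its real-cell assignment is $f(u)=s_u$ for $u<n$. A partial swap on registers $a\ne b$ is $U_{ab}(\beta)=\exp(-i\beta S_{ab})=\cos\beta\,I-i\sin\beta\,S_{ab}$, where $S_{ab}$ swaps the two complete registers. Each mixer layer $U_{M,\ell}$ ($0\le\ell\le p-1$) is a finite ordered product of partial swaps $U_{ab}(\beta_\ell)$. For a coefficient vector $c$, the cost phase is $U_C^{c}(\gamma)=\prod_{(u,v,w)\in E}\Phi_c(\gamma,w)$, with the factor for $(u,v,w)$ acting on registers $u$ (label $a$) and $v$ (label $b$). The prepared state is $$|\psi(\theta)\rangle=U_{M,p-1}U_C(\gamma_{p-1})\cdots U_{M,1}U_C(\gamma_1)U_{M,0}|f_0\rangle,$$ where $|f_0\rangle$ is a permutation basis state and $U_C$ is the chosen cost phase. *)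

(* Defs.v *)
From HB Require Import structures.
From mathcomp Require Import all_boot all_order all_fingroup all_algebra.
From mathcomp Require Import spectral.
From mathcomp Require Import all_classical all_reals all_analysis.
From mathcomp Require Import complex.
Set Implicit Arguments.
Unset Strict Implicit.
Unset Printing Implicit Defensive.
Import Order.TTheory GRing.Theory Num.Theory.
Import numFieldNormedType.Exports.
Local Open Scope ring_scope.
Local Open Scope complex_scope.

Section Operators.
Variable R : realType.
Implicit Types T : finType.

Definition cexp (z : R[i]) : R[i] :=
  (expR (complex.Re z))%:C * (cos (complex.Im z) +i* sin (complex.Im z)).

(* The Hilbert space with orthonormal basis (|x>)_{x : T} is 'cV[R[i]]_#|T|,
   the basis being ordered by enum_rank. *)
Definition ket T (x : T) : 'cV[R[i]]_#|T| := delta_mx (enum_rank x) 0.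

Definition operator T (A : T -> T -> R[i]) : 'M[R[i]]_#|T| :=
  \matrix_(i, j) A (enum_val i) (enum_val j).

Definition entry T (A : 'M[R[i]]_#|T|) (x y : T) : R[i] :=
  A (enum_rank x) (enum_rank y).

(* Entrywise limit of the partial sums of \sum_t A ^+ t / t!, for the topology
   of R[i] given by the modulus. *)
Definition expmx N (A : 'M[R[i]]_N) : 'M[R[i]]_N :=
  \matrix_(i, j)
    limn (fun t : nat => ((\sum_(r < t) (r`!%:R)^-1 *: A ^+ r) i j
                          : (R[i] : numClosedFieldType))).

End Operators.

Section Walsh.
Variable R : realType.

(* Bits at positions >= x of x vanish, as x < 2 ^ x. *)
Definition popcount (x : nat) : nat := #|[set q : 'I_x | Nat.testbit x q]|.

Definition walsh (z j : nat) : R := (-1) ^+ popcount (Nat.land z j).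

End Walsh.

Definition nbits (m : nat) : nat := up_log 2 m.

Definition label m (a : 'I_m) : 'I_(2 ^ nbits m) :=
  widen_ord (up_logP m (isT : (1 < 2)%N)) a.

Section Placement.
Variables (R : realType) (m : nat) (x y : 'I_m -> R).

Definition dist (a b : 'I_m) : R := `|x a - x b| + `|y a - y b|.

Definition cost n (E : seq ('I_n * 'I_n * R)) (f : 'I_n -> 'I_m) : R :=
  \sum_(e <- E) e.2 * dist (f e.1.1) (f e.1.2).

Definition feasible (c : 'cV[R]_(2 ^ (2 * nbits m))) : Prop :=
  forall a b : 'I_m,
    \sum_(j < 2 ^ (2 * nbits m)) walsh R (a + 2 ^ nbits m * b) j * c j 0
    = dist a b.

End Placement.

Section DistancePhase.
Variables (R : realType) (k : nat).

Local Notation pair_label := ('I_(2 ^ k) * 'I_(2 ^ k))%type.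

(* Qubits 0..k-1 of the 2k-qubit system are the bits of the first register,
   qubits k..2k-1 those of the second one; least significant bit first. *)
Definition qubit (z : pair_label) (q : nat) : bool :=
  if (q < k)%N then Nat.testbit z.1 q else Nat.testbit z.2 (q - k).

Definition pauliZ (q : nat) : 'M[R[i]]_#|{: pair_label}| :=
  operator (fun z' z : pair_label => if z' == z then (-1) ^+ qubit z q else 0).

Definition Zmask (j : nat) : 'M[R[i]]_#|{: pair_label}| :=
  \prod_(q < 2 * k | Nat.testbit j q) pauliZ q.

Definition dist_phase (c : 'cV[R]_(2 ^ (2 * k))) (gamma w : R) :
    'M[R[i]]_#|{: pair_label}| :=
  expmx ((- 'i * (gamma * w)%:C) *:
         \sum_(j < 2 ^ (2 * k)) (c j 0)%:C *: Zmask j).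

End DistancePhase.

Section TokenCircuit.
Variables (R : realType) (m k : nat).

(* Computational basis of m registers of k qubits each. *)
Definition registers : finType := {ffun 'I_m -> 'I_(2 ^ k)}.

(* The operator A on two registers, acting on registers a and b and tensored
   with the identity on all the other ones. *)
Definition on_registers (a b : 'I_m)
    (A : 'M[R[i]]_#|{: 'I_(2 ^ k) * 'I_(2 ^ k)}|) : 'M[R[i]]_#|registers| :=
  operator (fun s' s : registers =>
    if [forall r, (r != a) && (r != b) ==> (s' r == s r)]
    then entry A (s' a, s' b) (s a, s b) else 0).

Definition swap (a b : 'I_m) : 'M[R[i]]_#|registers| :=
  operator (fun s' s : registers =>
    if s' == [ffun r => s (tperm a b r)] then 1 else 0).

Definition partial_swap (a b : 'I_m) (beta : R) : 'M[R[i]]_#|registers| :=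
  expmx ((- 'i * beta%:C) *: swap a b).

Definition mixer (l : seq ('I_m * 'I_m)) (beta : R) : 'M[R[i]]_#|registers| :=
  \prod_(ab <- l) partial_swap ab.1 ab.2 beta.

(* The state after mixer layer l; the prepared state of a circuit with p >= 1
   mixer layers is the value at l = p - 1.  The values M l, beta l for l >= p,
   as well as gamma 0, are irrelevant to it. *)
Fixpoint prepared (M : nat -> seq ('I_m * 'I_m))
    (UC : R -> 'M[R[i]]_#|registers|) (beta gamma : nat -> R)
    (psi0 : 'cV[R[i]]_#|registers|) (l : nat) : 'cV[R[i]]_#|registers| :=
  if l is l'.+1 then
    mixer (M l) (beta l) *m (UC (gamma l) *m prepared M UC beta gamma psi0 l')
  else mixer (M 0%N) (beta 0%N) *m psi0.

End TokenCircuit.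

Section Permutations.
Variables (R : realType) (m n : nat) (nm : (n <= m)%N).

Definition perm_ket (s : {perm 'I_m}) : 'cV[R[i]]_#|registers m (nbits m)| :=
  @ket R (registers m (nbits m)) [ffun r => label (s r)].

(* Registers 0..n-1 are those of the cells. *)
Definition assignment (s : {perm 'I_m}) (u : 'I_n) : 'I_m :=
  s (widen_ord nm u).

Definition cost_phase (E : seq ('I_n * 'I_n * R))
    (c : 'cV[R]_(2 ^ (2 * nbits m))) (gamma : R) :
    'M[R[i]]_#|registers m (nbits m)| :=
  \prod_(e <- E) on_registers (widen_ord nm e.1.1) (widen_ord nm e.1.2)
                              (dist_phase c gamma e.2).

End Permutations.

(* Main.v *)
(** The operators [Zmask j] are simultaneously diagonal in the computational
    basis, with eigenvalue [walsh z j] on the encoded pair [z]; hence a distance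
    phase acts on a valid pair through [\sum_j W_zj c_j = d(a, b)] only,
    whatever the feasible [c] is.  Swaps permute the permutation basis states and
    are involutions, so that [exp (- i beta S) = cos beta - i sin beta S] and the
    mixers preserve the span of these states, on which all three cost phases
    coincide.  If [m = 2 ^ k], the feasibility equations form a square linear
    system with the Walsh matrix, which is invertible: splitting off the lowest
    bit of the indices reduces its injectivity to that of the Walsh matrix on
    one bit less. *)

Require Import Defs.
From Stdlib Require PeanoNat.
From mathcomp Require Import all_boot all_order all_fingroup all_algebra.
From mathcomp Require Import spectral.
From mathcomp Require Import all_classical all_reals all_analysis.
From mathcomp Require Import complex.
From mathcomp Require Import zify ring lra.
Set Implicit Arguments.
Unset Strict Implicit.
Unset Printing Implicit Defensive.
Import Order.TTheory GRing.Theory Num.Theory.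
Import numFieldNormedType.Exports.
Local Open Scope ring_scope.
Local Open Scope complex_scope.

(** * Binary digits and Walsh signs *)

Lemma div2_half x : Nat.div2 x = x./2.
Proof. by elim/ltn_ind: x => -[|[|x]] //= IH; rewrite IH. Qed.

Lemma Nat_oddE x : Nat.odd x = odd x.
Proof. by elim/ltn_ind: x => -[|[|x]] //= IH; rewrite negbK -IH. Qed.

Lemma testbitE x q : Nat.testbit x q = odd (x %/ 2 ^ q).
Proof.
elim: q x => [|q IH] x /=; first by rewrite expn0 divn1 Nat_oddE.
by rewrite IH expnS divnMA div2_half divn2.
Qed.

Lemma testbit_small x q : (x < 2 ^ q)%N -> Nat.testbit x q = false.
Proof. by move=> xq; rewrite testbitE divn_small. Qed.

Lemma testbit_concat k a b q : (a < 2 ^ k)%N ->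
  Nat.testbit (a + 2 ^ k * b) q
  = if (q < k)%N then Nat.testbit a q else Nat.testbit b (q - k).
Proof.
move=> ak; case: ltnP => [qk|kq]; rewrite !testbitE.
  (* For [q < k], the term [2 ^ k * b] is an even multiple of [2 ^ q], so it leaves bit [q]
     unchanged. *)
  rewrite -(subnK (ltnW qk)) expnD -mulnA [(2 ^ q * b)%N]mulnC mulnA.
  rewrite (addnC a) divnMDl ?expn_gt0// oddD oddM oddX.
  by rewrite orbF subn_eq0 leqNgt qk.
rewrite -{1}(subnKC kq) expnD divnMA (addnC a) mulnC divnMDl ?expn_gt0//.
by rewrite [(a %/ _)%N]divn_small// addn0.
Qed.

Lemma popcountE x K : (forall q, (K <= q)%N -> Nat.testbit x q = false) ->
  popcount x = (\sum_(q < K) Nat.testbit x q)%N.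
Proof.
move=> bitsK; rewrite /popcount -sum1dep_card big_mkcond /=.
rewrite (eq_bigr (fun q : 'I_x => Nat.testbit x q : nat)); last first.
  by move=> q _; case: ifP.
have extend N N' : (N <= N')%N ->
    (forall q, (N <= q)%N -> Nat.testbit x q = false) ->
    (\sum_(q < N') Nat.testbit x q = \sum_(q < N) Nat.testbit x q)%N.
  move=> NN' bitsN.
  rewrite -!(big_mkord xpredT (fun q => Nat.testbit x q : nat)).
  rewrite (big_cat_nat (leq0n N) NN') /= [X in (_ + X)%N]big_nat_cond.
  by rewrite [X in (_ + X)%N]big1 ?addn0// => q /andP[/andP[Nq _] _];
    rewrite bitsN.
(* Both sums are extended to the common range [maxn x K]; bits from [x] on vanish since
   [x < 2 ^ x]. *)
rewrite -(extend _ _ (leq_maxl x K)) ?(extend _ _ (leq_maxr x K))// => q xq.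
by rewrite testbit_small// (leq_ltn_trans xq)// ltn_expl.
Qed.

(** One sign per bit, the form in which Walsh signs meet products of Pauli operators. Bounding [j]
    alone suffices, as the bitwise AND has no bit outside [j]. *)
Lemma walshE (R : realType) K z j : (j < 2 ^ K)%N ->
  walsh R z j = \prod_(q < K) (-1) ^+ (Nat.testbit z q && Nat.testbit j q).
Proof.
move=> jK; rewrite /walsh (@popcountE _ K) => [|q Kq]; last first.
  rewrite PeanoNat.Nat.land_spec (@testbit_small j) ?andbF//.
  by rewrite (leq_trans jK)// leq_pexp2l.
rewrite expr_sum; apply: eq_bigr => q _.
by rewrite PeanoNat.Nat.land_spec.
Qed.

(** Kronecker structure of the Walsh matrix: the lowest bits contribute a 2 by 2 factor with entries
    [(-1) ^+ (a && b)]. *)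
Lemma walsh_double (R : realType) K z j (a b : bool) :
  (j < 2 ^ K)%N ->
  walsh R (a + z.*2) (b + j.*2) = (-1) ^+ (a && b) * walsh R z j.
Proof.
move=> jK.
have bit0 (e : bool) x : Nat.testbit (e + x.*2) 0 = e.
  by rewrite /= Nat_oddE oddD odd_double addbF oddb.
have bitS (e : bool) x q : Nat.testbit (e + x.*2) q.+1 = Nat.testbit x q.
  by rewrite /= div2_half half_bit_double.
rewrite (@walshE R K.+1) ?(@walshE R K)//; last first.
  by rewrite expnS; case: b; lia.
rewrite big_ord_recl !bit0; congr (_ * _); apply: eq_bigr => q _.
by rewrite !bitS.
Qed.

Lemma sum_nat_double (V : nmodType) (F : nat -> V) n :
  \sum_(0 <= j < n.*2) F j = \sum_(0 <= j < n) (F j.*2 + F j.*2.+1).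
Proof.
elim: n => [|n IH]; first by rewrite !big_geq.
by rewrite doubleS !big_nat_recr//= IH addrA.
Qed.

(** Induction on the number of bits. Rows [2z] and [2z + 1] of the system say that the vectors of
    sums and of differences of [c (2j)] and [c (2j + 1)] lie in the kernel of the smaller Walsh
    matrix; both vanish, hence so does [c]. Indexing [c] by [nat] avoids casts between ordinal
    types. *)
Lemma walsh_inj (R : realType) K (c : nat -> R) :
  (forall z, (z < 2 ^ K)%N -> \sum_(0 <= j < 2 ^ K) walsh R z j * c j = 0) ->
  forall j, (j < 2 ^ K)%N -> c j = 0.
Proof.
elim: K c => [|K IH] c Wc j jK.
  have := Wc 0%N isT; rewrite big_nat1 (@walshE R 0)// big_ord0 mul1r.
  by case: j jK.
have halves (a : bool) z : (z < 2 ^ K)%N -> \sum_(0 <= j < 2 ^ K)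
    walsh R z j * (c j.*2 + (-1) ^+ a * c j.*2.+1) = 0.
  move=> zK; rewrite -[RHS](Wc (a + z.*2)%N); last first.
    by rewrite expnS; case: a; lia.
  rewrite expnS mul2n sum_nat_double; apply: eq_big_nat => i /andP[_ iK].
  have := walsh_double R z a false iK; rewrite add0n => ->.
  have := walsh_double R z a true iK; rewrite add1n => ->.
  by case: a; rewrite /= ?expr0 ?expr1; ring.
have sum (a : bool) i : (i < 2 ^ K)%N -> c i.*2 + (-1) ^+ a * c i.*2.+1 = 0.
  exact: (IH (fun i => c i.*2 + (-1) ^+ a * c i.*2.+1) (halves a)).
have jK' : (j./2 < 2 ^ K)%N by rewrite expnS in jK; lia.
rewrite -(odd_double_half j); move: (odd j) j./2 jK' => b i iK.
have := sum true _ iK; have := sum false _ iK; rewrite expr0 expr1.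
by case: b; rewrite ?add0n ?add1n => s0 s1; lra.
Qed.

(** * Operators applied to basis vectors *)

Lemma mulmx_ket (R : realType) (T : finType) N (A : 'M[R[i]]_(N, #|T|))
    (x : T) i :
  (A *m ket R x) i 0 = A i (enum_rank x).
Proof. by rewrite /ket -colE mxE. Qed.

Lemma ketE (R : realType) (T : finType) (x x' : T) j :
  ket R x (enum_rank x') j = (x' == x)%:R.
Proof. by rewrite mxE ord1 eqxx andbT (inj_eq enum_rank_inj). Qed.

Lemma operator_diag_ket (R : realType) (T : finType) (A : T -> T -> R[i]) x d :
  (forall x', A x' x = if x' == x then d else 0) ->
  operator A *m ket R x = d *: ket R x.
Proof.
move=> Ax; apply/matrixP => i j; rewrite ord1 mulmx_ket !mxE enum_rankK Ax.
rewrite -(inj_eq enum_rank_inj) enum_valK eqxx andbT.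
by case: eqP; rewrite ?mulr1 ?mulr0.
Qed.

(* The cast selects the topology of R[i] given by the modulus. *)
Local Notation C R := (complex R : numClosedFieldType).

(** * The exponential series at imaginary arguments *)

Lemma eq_cvgn (K : numFieldType) (f g : nat -> K) (l l' : K) :
  f =1 g -> l = l' -> (f @ \oo --> l)%classic -> (g @ \oo --> l')%classic.
Proof. by move=> /funext -> ->. Qed.

Section ImaginaryExponential.
Variable R : realType.
Implicit Types t : R.

Lemma cvg_real_complex (u : nat -> R) (l : R) :
  ((u : nat -> R^o) @ \oo --> (l : R^o) ->
   (fun N => (u N)%:C : C R) @ \oo --> (l%:C : C R))%classic.
Proof.
move=> /cvgrPdist_lt ul; apply/cvgrPdist_lt => -[e e'].
(* A positive element of [R[i]] has zero imaginary part, so the tolerance is a real number. *)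
rewrite ltcE /= => /andP[/eqP -> e0].
have := ul e e0; apply: filterS => N.
by rewrite -rmorphB normc_def /= expr0n addr0 sqrtr_sqr ltcR.
Qed.

Lemma cexp_imag t : cexp (- 'i * t%:C) = cos t -i* sin t.
Proof.
rewrite /cexp /= !(mul0r, mulr0, oppr0, subr0, add0r, addr0) expR0.
by rewrite mulN1r mul1r cosN sinN.
Qed.

Lemma cexp_imagD t u :
  cexp (- 'i * (t + u)%:C) = cexp (- 'i * t%:C) * cexp (- 'i * u%:C).
Proof.
rewrite !cexp_imag cosD sinD; apply/eqP; rewrite eq_complex /=.
by apply/andP; split; apply/eqP; ring.
Qed.

Lemma sqr_imag : (- 'i : R[i]) ^+ 2 = -1.
Proof. by rewrite sqrrN sqr_i. Qed.

Lemma expr_imag_even t r : ~~ odd r ->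
  (r`!%:R)^-1 * (- 'i * t%:C) ^+ r = (cos_coeff t r)%:C.
Proof.
move=> r_even; rewrite cos_coeffE r_even mul1r exprMn.
rewrite -{2}(odd_double_half r) (negbTE r_even) add0n -mul2n exprM sqr_imag.
rewrite !(rmorphM, rmorphXn, rmorphN, rmorph1, fmorphV, rmorph_nat) /=.
by ring.
Qed.

Lemma expr_imag_odd t r : odd r ->
  (r`!%:R)^-1 * (- 'i * t%:C) ^+ r = - 'i * (sin_coeff t r)%:C.
Proof.
case: r => // r; move=> r_odd; rewrite sin_coeffE r_odd mul1r exprMn.
have r_even : ~~ odd r by [].
rewrite exprS -{2}(odd_double_half r) (negbTE r_even) add0n -mul2n exprM.
rewrite sqr_imag.
rewrite !(rmorphM, rmorphXn, rmorphN, rmorph1, fmorphV, rmorph_nat) /=.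
by ring.
Qed.

(** Terms of the other parity are replaced by 0 rather than skipped, so that the even and odd
    partial sums of the same length add up to those of the exponential series. *)
Lemma cvg_expr_imag_even t :
  ((fun N : nat => \sum_(r < N)
      (if odd r then 0 else (r`!%:R)^-1 * (- 'i * t%:C) ^+ r) : C R)
    @ \oo --> ((cos t)%:C : C R))%classic.
Proof.
have : (series (cos_coeff t) @ \oo --> (cos t : R^o))%classic.
  by rewrite cos.unlock; exact: is_cvg_series_cos_coeff.
move=> /cvg_real_complex; apply: eq_cvgn => // N.
rewrite /series /= big_mkord rmorph_sum; apply: eq_bigr => r _ /=.
case: ifPn => [r_odd|r_even]; last by rewrite expr_imag_even.
by rewrite -(odd_double_half r) r_odd add1n cos_coeff_odd.
Qed.

Lemma cvg_expr_imag_odd t :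
  ((fun N : nat => \sum_(r < N)
      (if odd r then (r`!%:R)^-1 * (- 'i * t%:C) ^+ r else 0) : C R)
    @ \oo --> (- 'i * (sin t)%:C : C R))%classic.
Proof.
have : (series (sin_coeff t) @ \oo --> (sin t : R^o))%classic.
  by rewrite sin.unlock; exact: is_cvg_series_sin_coeff.
move=> /cvg_real_complex /(cvgMl_tmp (a := (- 'i : C R))).
apply: eq_cvgn => // N.
rewrite /series /= big_mkord rmorph_sum mulr_sumr; apply: eq_bigr => r _ /=.
case: ifPn => [r_odd|r_even]; first by rewrite expr_imag_odd.
by rewrite -(odd_double_half r) (negbTE r_even) add0n sin_coeff_even mulr0.
Qed.

Lemma cvg_expr_imag t :
  ((fun N : nat => \sum_(r < N) (r`!%:R)^-1 * (- 'i * t%:C) ^+ r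
     : C R) @ \oo --> (cexp (- 'i * t%:C) : C R))%classic.
Proof.
apply: (eq_cvgn _ _ (cvgD (@cvg_expr_imag_even t)
  (@cvg_expr_imag_odd t))) => [N|].
  rewrite fctE -big_split; apply: eq_bigr => r _.
  by rewrite /=; case: ifP; rewrite ?addr0 ?add0r.
rewrite cexp_imag; apply/eqP; rewrite eq_complex /=.
by apply/andP; split; apply/eqP; ring.
Qed.

End ImaginaryExponential.

(** * Matrix exponentials on an eigenvector and of an involution *)

(** Every power of [A] scales [ket R x], so column [x] of the matrix series is the scalar series
    times [ket R x], and the limit can be taken entrywise. *)
Lemma expmx_ket (R : realType) (T : finType) (A : 'M[R[i]]_#|T|)
    (x : T) (t : R) :
  A *m ket R x = (- 'i * t%:C) *: ket R x ->
  expmx A *m ket R x = cexp (- 'i * t%:C) *: ket R x.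
Proof.
move=> Ax.
have powA r : A ^+ r *m ket R x = (- 'i * t%:C) ^+ r *: ket R x.
  elim: r => [|r IH]; first by rewrite !expr0 scale1r mul1mx.
  by rewrite exprSr -mulmxE -mulmxA Ax -scalemxAr IH scalerA mulrC -exprSr.
apply/matrixP => i j; rewrite ord1 mulmx_ket [LHS]mxE [RHS]mxE.
apply: (@cvg_lim (C R)); first exact: norm_hausdorff.
apply: (eq_cvgn _ _ (cvgMr_tmp
  (b := (ket R x i 0 : C R)) (@cvg_expr_imag R t))) => [N|//].
rewrite summxE mulr_suml; apply: eq_bigr => r _.
by rewrite -mulmx_ket -scalemxAl powA scalerA [RHS]mxE.
Qed.

(** Even powers of [A] are the identity and odd ones are [A], so the series splits into its cosine
    and sine halves. *)
Lemma expmx_involution (R : realType) N (A : 'M[R[i]]_N) (t : R) :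
  A *m A = 1%:M ->
  expmx ((- 'i * t%:C) *: A) = (cos t)%:C *: 1%:M + (- 'i * (sin t)%:C) *: A.
Proof.
move=> AA.
have powA r : ((- 'i * t%:C) *: A) ^+ r
    = (- 'i * t%:C) ^+ r *: (if odd r then A else 1%:M).
  elim: r => [|r IH]; first by rewrite !expr0 scale1r.
  rewrite exprSr IH -mulmxE -scalemxAl -scalemxAr scalerA -exprSr /=.
  by case: (odd r); rewrite /= ?AA ?mul1mx.
apply/matrixP => i j.
rewrite [LHS]mxE [RHS]mxE [X in _ = X + _]mxE [X in _ = _ + X]mxE.
apply: (@cvg_lim (C R)); first exact: norm_hausdorff.
apply: (eq_cvgn _ _ (cvgD
  (cvgMr_tmp (b := ((1%:M : 'M[R[i]]_N) i j : C R)) (@cvg_expr_imag_even R t))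
  (cvgMr_tmp (b := (A i j : C R)) (@cvg_expr_imag_odd R t)))) => [M|//].
rewrite summxE fctE !mulr_suml -big_split; apply: eq_bigr => r _ /=.
by rewrite powA scalerA [RHS]mxE; case: ifP; rewrite mul0r ?add0r ?addr0.
Qed.

(** * Eigenvalues of the phases on basis states *)

Section Circuit.
Variable R : realType.

Lemma prod_ket (T : finType) (I : Type) (r : seq I) (P : pred I)
    (A : I -> 'M[R[i]]_#|T|) (d : I -> R[i]) (x : T) :
  (forall i, P i -> A i *m ket R x = d i *: ket R x) ->
  (\prod_(i <- r | P i) A i) *m ket R x = (\prod_(i <- r | P i) d i) *: ket R x.
Proof.
move=> Ax; elim: r => [|i r IH]; first by rewrite !big_nil mul1mx scale1r.
rewrite !big_cons; case: ifPn => // Pi.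
by rewrite -mulmxE -mulmxA IH -scalemxAr Ax// scalerA mulrC.
Qed.

Lemma Zmask_ket k j (a b : 'I_(2 ^ k)) : (j < 2 ^ (2 * k))%N ->
  Zmask R k j *m ket R (a, b)
  = (walsh R (a + 2 ^ k * b) j)%:C *: ket R (a, b).
Proof.
move=> jk; rewrite (walshE _ _ jk) rmorph_prod /=.
rewrite (@prod_ket _ _ _ _ _ (fun q : 'I_(2 * k) => (-1) ^+ qubit (a, b) q)).
  (* Qubits outside the mask contribute a factor 1 on both sides. *)
  rewrite big_mkcond; congr (_ *: _); apply: eq_bigr => q _.
  rewrite testbit_concat// -/(qubit (a, b) q).
  by case: ifP => _; rewrite ?andbT ?andbF rmorph_sign.
by move=> q _; apply: operator_diag_ket => z'; case: eqP => // ->.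
Qed.

Lemma dist_phase_ket m (x y : 'I_m -> R) c : feasible x y c ->
  forall gamma w a b,
  dist_phase c gamma w *m ket R (label a, label b)
  = cexp (- 'i * (gamma * w * dist x y a b)%:C) *: ket R (label a, label b).
Proof.
move=> fc gamma w a b; apply: expmx_ket.
rewrite -scalemxAl mulmx_suml.
under eq_bigr => j _ do rewrite -scalemxAl Zmask_ket// scalerA.
rewrite -scaler_suml scalerA; congr (_ *: _).
rewrite [in RHS]rmorphM mulrA; congr (_ * _).
(* Feasibility turns the distance back into the Walsh sum at the encoded pair, which is the
   eigenvalue found for the exponent. *)
rewrite -fc rmorph_sum /=; apply: eq_bigr => j _.
by rewrite rmorphM mulrC.
Qed.

Lemma on_registers_ket m k (a b : 'I_m) A (s : registers m k) d :
  A *m ket R (s a, s b) = d *: ket R (s a, s b) ->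
  on_registers a b A *m ket R s = d *: ket R s.
Proof.
move=> As; apply: operator_diag_ket => s'.
case: forallP => [agree|]; last first.
  by case: eqP => // -> []; move=> r; rewrite eqxx implybT.
rewrite /entry -mulmx_ket As mxE ketE xpair_eqE.
(* As [s'] and [s] agree off [a] and [b], equality need only be tested on these two registers. *)
have -> : (s' == s) = (s' a == s a) && (s' b == s b).
  apply/eqP/andP => [->//|[/eqP sa /eqP sb]].
  apply/ffunP => r; have := agree r.
  by case: eqVneq => [->|ra] //; case: eqVneq => [->|rb] //= /eqP.
by case: ifP; rewrite ?mulr1 ?mulr0.
Qed.

Lemma cost_phase_ket m n (nm : (n <= m)%N) (x y : 'I_m -> R) c E gamma
    (s : {perm 'I_m}) : feasible x y c ->
  cost_phase nm E c gamma *m perm_ket R s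
  = cexp (- 'i * (gamma * cost x y E (assignment nm s))%:C) *: perm_ket R s.
Proof.
move=> fc; rewrite /cost_phase.
rewrite (@prod_ket _ _ _ _ _ (fun e => cexp (- 'i * (gamma * (e.2 *
  dist x y (assignment nm s e.1.1) (assignment nm s e.1.2)))%:C))); last first.
  move=> e _; apply: on_registers_ket; rewrite !ffunE mulrA.
  exact: dist_phase_ket.
(* The phases of the nets multiply, so their exponents add up to the total cost. *)
congr (_ *: _); rewrite /cost; elim: E => [|e E IH].
  by rewrite !big_nil mulr0 cexp_imag cos0 sin0 oppr0.
by rewrite !big_cons IH -cexp_imagD -mulrDr.
Qed.

(** * The span of the permutation basis states and its invariance under mixers *)

(** Explicit coefficients let an operator known only on the permutation basis states be applied term
    by term. *)
Definition perm_span m (v : 'cV[R[i]]_#|registers m (nbits m)|) :=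
  exists h : {perm 'I_m} -> R[i], v = \sum_s h s *: perm_ket R s.

Lemma perm_ket_span m (s : {perm 'I_m}) : perm_span (perm_ket R s).
Proof.
exists (fun s' => (s' == s)%:R).
rewrite (bigD1 s)//= eqxx scale1r big1 ?addr0// => s' /negbTE ->.
by rewrite scale0r.
Qed.

Lemma perm_spanD m v w : @perm_span m v -> perm_span w -> perm_span (v + w).
Proof.
move=> [h ->] [h' ->]; exists (fun s => h s + h' s).
by rewrite -big_split; apply: eq_bigr => s _; rewrite scalerDl.
Qed.

Lemma perm_spanZ m a v : @perm_span m v -> perm_span (a *: v).
Proof.
move=> [h ->]; exists (fun s => a * h s).
by rewrite scaler_sumr; apply: eq_bigr => s _; rewrite scalerA.
Qed.

Lemma perm_span_sum m (I : finType) (v : I -> _) :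
  (forall i, @perm_span m (v i)) -> perm_span (\sum_i v i).
Proof.
move=> vs; elim/big_ind: _ => //; last exact: perm_spanD.
by exists (fun=> 0); rewrite big1// => s _; rewrite scale0r.
Qed.

Lemma swap_ket m k (a b : 'I_m) (s : registers m k) :
  swap R k a b *m ket R s = ket R ([ffun r => s (tperm a b r)] : registers m k).
Proof.
apply/matrixP => i j; rewrite ord1 mulmx_ket !mxE enum_rankK.
rewrite -(inj_eq enum_rank_inj) enum_valK andbT.
by case: eqP.
Qed.

Lemma swapK m k (a b : 'I_m) : swap R k a b *m swap R k a b = 1%:M.
Proof.
apply/matrixP => i j; rewrite -(enum_valK j).
rewrite -mulmx_ket -mulmxA !swap_ket mxE enum_valK.
rewrite (_ : [ffun r => _] = enum_val j) ?enum_valK ?mxE ?andbT//.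
by apply/ffunP => r; rewrite !ffunE tpermK.
Qed.

Lemma swap_span m (a b : 'I_m) v :
  @perm_span m v -> perm_span (swap R (nbits m) a b *m v).
Proof.
move=> [h ->]; rewrite mulmx_sumr; apply: perm_span_sum => s.
rewrite -scalemxAr swap_ket; apply: perm_spanZ.
(* In a product of permutations the left factor acts first: swapping registers precomposes [s] with
   a transposition. *)
rewrite (_ : ket R _ = perm_ket R (tperm a b * s)); first exact: perm_ket_span.
by congr (ket R _); apply/ffunP => r; rewrite !ffunE permM.
Qed.

Lemma mixer_span m (l : seq ('I_m * 'I_m)) beta v :
  @perm_span m v -> perm_span (mixer (nbits m) l beta *m v).
Proof.
rewrite /mixer; elim: l v => [|ab l IH] v vs; first by rewrite big_nil mul1mx.
rewrite big_cons -mulmxE -mulmxA; move: (IH _ vs) => {}vs.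
rewrite /partial_swap expmx_involution ?swapK// mulmxDl -!scalemxAl mul1mx.
by apply: perm_spanD; apply: perm_spanZ => //; apply: swap_span.
Qed.

Lemma prepared_eq m M (UC UC' : R -> 'M[R[i]]_#|registers m (nbits m)|)
    (d : R -> {perm 'I_m} -> R[i]) beta gamma (s0 : {perm 'I_m}) l :
  (forall g s, UC g *m perm_ket R s = d g s *: perm_ket R s) ->
  (forall g s, UC' g *m perm_ket R s = d g s *: perm_ket R s) ->
  prepared M UC beta gamma (perm_ket R s0) l
  = prepared M UC' beta gamma (perm_ket R s0) l.
Proof.
move=> UCs UC's.
(* The two cost phases are only known to agree on the span, so the induction also carries membership
   of the state in it. *)
suff [] : prepared M UC beta gamma (perm_ket R s0) l
    = prepared M UC' beta gamma (perm_ket R s0) l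
  /\ perm_span (prepared M UC beta gamma (perm_ket R s0) l) by [].
elim: l => [|l] /=; last move=> [<- [h ->]].
  by split=> //; apply/mixer_span/perm_ket_span.
split.
  congr (_ *m _); rewrite !mulmx_sumr.
  by apply: eq_bigr => s _; rewrite -!scalemxAr UCs UC's.
rewrite mulmx_sumr; apply/mixer_span/perm_span_sum => s.
by rewrite -scalemxAr UCs; do 2!apply: perm_spanZ; apply: perm_ket_span.
Qed.

End Circuit.

(** * Uniqueness of the coefficients when the number of sites is a power of two *)

Lemma exists_unique_feasible (R : realType) m (x y : 'I_m -> R) :
  m = (2 ^ nbits m)%N ->
  exists! c : 'cV[R]_(2 ^ (2 * nbits m)), feasible x y c.
Proof.
move=> mE; set k := nbits m in mE *.
pose W : 'M[R]_(2 ^ (2 * k)) := \matrix_(z, j) walsh R z j.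
have Wunit : W \in unitmx.
  rewrite -unitmx_tr -row_free_unit; apply: inj_row_free => v vW.
  apply/rowP => j; rewrite mxE.
  (* The row [v] is extended by 0 to all of [nat], the form expected by [walsh_inj]. *)
  pose c i := if insub i is Some i' then v 0 i' else 0.
  have cE (i : 'I_(2 ^ (2 * k))) : c i = v 0 i by rewrite /c valK.
  rewrite -cE; apply: (@walsh_inj R (2 * k)) => // z zk.
  have := congr1 (fun u : 'rV_ _ => u 0 (Ordinal zk)) vW; rewrite !mxE => vWz.
  rewrite -[RHS]vWz big_mkord; apply: eq_bigr => i _.
  by rewrite cE !mxE mulrC.
have ltm (a : nat) : (a < 2 ^ k)%N -> (a < m)%N by rewrite mE.
have modk (z : nat) : (z %% 2 ^ k < m)%N by rewrite ltm// ltn_mod expn_gt0.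
have divk (z : 'I_(2 ^ (2 * k))) : (z %/ 2 ^ k < m)%N.
  by rewrite ltm// ltn_divLR ?expn_gt0// -expnD addnn -mul2n.
(* Every index [z] now encodes a valid pair, recovered as remainder and quotient by [2 ^ k];
   feasibility becomes the square system [W *m c = D]. *)
pose D : 'cV[R]_(2 ^ (2 * k)) :=
  \col_z dist x y (Ordinal (modk z)) (Ordinal (divk z)).
have feasibleE c : feasible x y c <-> W *m c = D.
  split=> [fc|WcD a b].
    apply/colP => z; rewrite !mxE -fc /=; apply: eq_bigr => j _.
    have zE : (z %% 2 ^ k + 2 ^ k * (z %/ 2 ^ k) = z)%N.
      by rewrite addnC mulnC -divn_eq.
    by rewrite !mxE zE.
  have am : (a < 2 ^ k)%N by rewrite -mE.
  have bm : (b < 2 ^ k)%N by rewrite -mE.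
  have zk : (a + 2 ^ k * b < 2 ^ (2 * k))%N.
    rewrite mul2n -addnn expnD (@leq_trans (2 ^ k * b.+1))//.
      by rewrite mulnS ltn_add2r.
    by rewrite leq_mul2l bm orbT.
  have := congr1 (fun u : 'cV_ _ => u (Ordinal zk) 0) WcD.
  rewrite !mxE /= => Dz.
  rewrite (eq_bigr (fun j => W (Ordinal zk) j * c j 0)); last first.
    by move=> j _; rewrite mxE.
  rewrite Dz; congr dist; apply: val_inj => /=.
    by rewrite addnC mulnC modnMDl modn_small.
  by rewrite addnC mulnC divnMDl ?expn_gt0// divn_small ?addn0.
exists (invmx W *m D); split; first by apply/feasibleE; rewrite mulKVmx.
by move=> c /feasibleE <-; rewrite mulKmx.
Qed.

Theorem proposition3 (R : realType) (m n : nat) (n_gt0 : (1 <= n)%N)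
    (nm : (n <= m)%N) (x y : 'I_m -> R) :
  (forall c c' : 'cV[R]_(2 ^ (2 * nbits m)),
     feasible x y c -> feasible x y c' ->
     (* (i) *)
     (forall (gamma w : R) (a b : 'I_m),
        dist_phase c gamma w *m ket R (label a, label b)
          = dist_phase c' gamma w *m ket R (label a, label b)
        /\ dist_phase c' gamma w *m ket R (label a, label b)
          = cexp (- 'i * (gamma * w * dist x y a b)%:C)
              *: ket R (label a, label b))
     /\
     (* (ii) *)
     (forall (E : seq ('I_n * 'I_n * R)),
        uniq E -> (forall e, e \in E -> e.1.1 != e.1.2) ->
      forall (p : nat) (M : nat -> seq ('I_m * 'I_m)),
        (1 <= p)%N ->
        (forall l ab, (l < p)%N -> ab \in M l -> ab.1 != ab.2) ->
      forall (s0 : {perm 'I_m}) (beta gamma : nat -> R)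
        (Ustar : R -> 'M[R[i]]_#|registers m (nbits m)|),
        (forall g, is_diag_mx (Ustar g)) ->
        (forall g, Ustar g \is unitarymx) ->
        (forall g (s : {perm 'I_m}),
           Ustar g *m perm_ket R s
           = cexp (- 'i * (g * cost x y E (assignment nm s))%:C)
               *: perm_ket R s) ->
        prepared M (cost_phase nm E c) beta gamma (perm_ket R s0) p.-1
          = prepared M Ustar beta gamma (perm_ket R s0) p.-1
        /\ prepared M (cost_phase nm E c') beta gamma (perm_ket R s0) p.-1
          = prepared M Ustar beta gamma (perm_ket R s0) p.-1))
  /\
  (* (iii) *)
  (m = (2 ^ nbits m)%N ->
     exists! c : 'cV[R]_(2 ^ (2 * nbits m)), feasible x y c).
Proof.
split; last exact: exists_unique_feasible.
move=> c c' fc fc'; split.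
  move=> gamma w a b; have phase' := dist_phase_ket fc' gamma w a b.
  by split; [exact: etrans (dist_phase_ket fc gamma w a b) (esym phase')|].
move=> E _ _ p M _ _ s0 beta gamma Ustar _ _ Us.
(* The eigenvalues of [Ustar] on permutation states are also those of either cost phase. *)
by split; apply: prepared_eq Us => g s; exact: cost_phase_ket.
Qed.
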